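(* Let $H$ be a full-line discrete Schrödinger operator on $\ell^2(\mathbb{Z})$ with bounded real potential $V$, and let $H^{\pm}$ be its half-line restrictions. For any $q>1$ and any $T>0$, $$P_{\delta_0}(q,T)\le T^2\bigl(P^+_{\delta_1}(q,T)+P^-_{\delta_1}(q,T)\bigr).$$
   Context: $V=(V_n)_{n\in\mathbb{Z}}$ is a bounded real sequence, and $(H\psi)_n=\psi_{n+1}+\psi_{n-1}+V_n\psi_n$ on $\ell^2(\mathbb{Z})$. With $\mathbb{N}=\{1,2,\dots\}$, the operators $H^\pm$ on $\ell^2(\mathbb{N})$ are the restrictions of $H$ to the positive and negative half-lines (the latter reflected): $(H^\pm\psi)_n=\psi_{n+1}+\psi_{n-1}+V_{\pm n}\psi_n$ for $n\ge2$ and $(H^\pm\psi)_1=\psi_2+V_{\pm1}\psi_1$ (so $V_0$ appears in neither). Moreover $$P_{\delta_0}(q,T)=\sum_{n\in\mathbb{Z},\,|n|>q}\frac2T\int_0^\infty\bigl|\langle\delta_n,e^{-itH}\delta_0\rangle\bigr|^2e^{-2t/T}dt,\qquad P^\pm_{\delta_1}(q,T)=\sum_{n\in\mathbb{N},\,n>q}\frac2T\int_0^\infty\bigl|\langle\delta_n,e^{-itH^\pm}\delta_1\rangle\bigr|^2e^{-2t/T}dt .$$ *)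

(* Defs.v *)
From HB Require Import structures.
From mathcomp Require Import all_boot all_order all_algebra.
From mathcomp Require Export complex.
From mathcomp Require Import all_classical all_reals all_analysis.

Set Implicit Arguments.
Unset Strict Implicit.
Unset Printing Implicit Defensive.

Import Order.TTheory GRing.Theory Num.Theory.
Import ComplexField.Normc.

Local Open Scope classical_set_scope.
Local Open Scope ring_scope.
Local Open Scope complex_scope.

Section HilbertSpace.
Variables (R : realType) (I : choiceType).
Implicit Types (phi psi : I -> R[i]) (A : (I -> R[i]) -> (I -> R[i])).

Definition l2norm_sq psi : \bar R :=
  (\esum_(n in [set: I]) ((normc (psi n)) ^+ 2)%:E)%E.

Definition l2 psi : Prop := (l2norm_sq psi < +oo)%E.

(* Unordered sum of an absolutely summable real family; [\esum] itself is only
   meaningful for nonnegative families. *)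
Definition rsum (f : I -> R) : R :=
  fine (\esum_(n in [set: I]) (Num.max (f n) 0)%:E)%E
  - fine (\esum_(n in [set: I]) (Num.max (- f n) 0)%:E)%E.

Definition csum (f : I -> R[i]) : R[i] :=
  rsum (fun n => complex.Re (f n)) +i* rsum (fun n => complex.Im (f n)).

Definition inner phi psi : R[i] := csum (fun n => (phi n)^* * psi n).

Definition delta (m : I) : I -> R[i] := fun n => (n == m)%:R.

Definition exp_partial A psi (N : nat) : I -> R[i] :=
  fun n => \sum_(k < N) (k`!%:R)^-1 * iter k A psi n.

(* The vector e^A psi of l^2: the limit in l^2 norm of the exponential series.
   Limits are unique, so [xget] makes no arbitrary choice; for a bounded
   operator [A] and [psi] in l^2 the limit exists. *)
Definition op_exp A psi : I -> R[i] :=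
  xget (fun=> 0) [set phi | l2 phi /\
    l2norm_sq (fun n => exp_partial A psi N n - phi n) @[N --> \oo] --> 0%E].

Definition evolution A (t : R) psi : I -> R[i] :=
  op_exp (fun chi n => - ('i * t%:C) * A chi n) psi.

Definition time_averaged_prob A phi psi (T : R) : \bar R :=
  ((2 / T)%:E * \int[lebesgue_measure]_(t in `[0%R, +oo[)
     ((normc (inner phi (evolution A t psi))) ^+ 2
        * expR (- (2 * t / T)))%:E)%E.

End HilbertSpace.

Section Schroedinger.
Variable R : realType.
Implicit Types (V : int -> R) (q T : R).

Definition bounded_potential V : Prop := exists M : R, forall n, `|V n| <= M.

(* The formula makes sense for every complex sequence; it preserves l^2 when
   [V] is bounded. *)
Definition schroedinger V (psi : int -> R[i]) : int -> R[i] :=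
  fun n => psi (n + 1) + psi (n - 1) + (V n)%:C * psi n.

(* Half-line sites n = 1, 2, ... are indexed by k : nat with n = k.+1, so the
   first equation is at index 0 and delta_1 is [delta 0]. *)
Definition half_schroedinger (W : nat -> R) (psi : nat -> R[i])
    : nat -> R[i] :=
  fun k => match k with
           | 0 => psi 1 + (W 0)%:C * psi 0
           | j.+1 => psi j.+2 + psi j + (W j.+1)%:C * psi j.+1
           end.

Definition schroedinger_plus V := half_schroedinger (fun k => V k.+1%:Z).

Definition schroedinger_minus V := half_schroedinger (fun k => V (- k.+1%:Z)).

Definition P_full V q T : \bar R :=
  (\esum_(n in [set n : int | (q < `|n|%:~R)%R])
     time_averaged_prob (schroedinger V) (delta R n) (delta R 0%R) T)%E.

Definition P_half (A : (nat -> R[i]) -> (nat -> R[i])) q T : \bar R :=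
  (\esum_(k in [set k : nat | (q < k.+1%:R)%R])
     time_averaged_prob A (delta R k) (delta R 0%N) T)%E.

Definition P_plus V := P_half (schroedinger_plus V).

Definition P_minus V := P_half (schroedinger_minus V).

End Schroedinger.

(* Main.v *)
(* In the time domain, write psi(t) = e^{-itH} delta_0 and u(t) = e^{-itH^+} delta_1.
   On the half-line n >= 1 the sequence psi solves the half-line equation with the
   source psi_0(t) at site 1, so by Duhamel
     psi_n(t) = -i int_0^t u_n(t - s) psi_0(s) ds,   and   |psi_0| <= 1 by unitarity.
   Cauchy-Schwarz then gives |psi_n(t)|^2 <= T e^{t/T} int_0^t |u_n(r)|^2 e^{-r/T} dr,
   and integrating against e^{-2t/T} produces the factor T^2 site by site; the sites
   n <= -1 follow by reflecting the potential.
   Both the unitarity bound and Duhamel's formula come from Green's identity on a finite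
   window: the boundary terms vanish because psi_n(t), a power series in t with
   coefficients O(C^k 2^{-|n|} / k!), decays exponentially in |n|. *)
Require Import Defs.
From mathcomp Require Import all_boot all_order all_algebra.
From mathcomp Require Import all_classical all_reals all_analysis.
From mathcomp Require Import measurable_realfun.
From mathcomp Require Import ring lra zify.

Set Implicit Arguments.
Unset Strict Implicit.
Unset Printing Implicit Defensive.

Import Order.TTheory GRing.Theory Num.Theory.
Import ComplexField.Normc.
Import numFieldNormedType.Exports.

Local Open Scope classical_set_scope.
Local Open Scope ring_scope.

(** * Exponential generating functions *)

Section ExponentialGeneratingFunction.
Variable R : realType.
Implicit Types (g : nat -> R) (B C t : R).

Definition exp_bounded B C g := forall k, `|g k| <= B * C ^+ k.

(** The factorial is kept apart from [g], so that differentiation becomes a shift of [g]. *)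
Definition egf g t : R := limn (pseries (fun k => g k / k`!%:R) t).

Lemma exp_bounded_term B C g t k : 0 <= C -> exp_bounded B C g ->
  `|g k / k`!%:R * t ^+ k| <= B * exp_coeff (C * `|t|) k.
Proof.
move=> C0 gB; rewrite /exp_coeff /= !normrM normfV normrX exprMn.
rewrite (ger0_norm (ler0n _ _)).
have /ler_wpM2r : 0 <= k`!%:R^-1 * `|t| ^+ k :> R.
  by rewrite mulr_ge0 ?invr_ge0 ?exprn_ge0.
by move=> /(_ _ _ (gB k)); rewrite !mulrA => /le_trans; apply; lra.
Qed.

Lemma cvg_egf B C g t : 0 <= C -> exp_bounded B C g ->
  pseries (fun k => g k / k`!%:R) t @ \oo --> egf g t.
Proof.
move=> C0 gB; apply/(@normed_cvg _ R^o).
apply: (@series_le_cvg _ _ (fun k => B * exp_coeff (C * `|t|) k)) => [k|k|k|].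
- exact: normr_ge0.
- exact: le_trans (exp_bounded_term _ _ C0 gB).
- exact: exp_bounded_term C0 gB.
- apply: is_cvg_seriesZ; exact: is_cvg_series_exp_coeff.
Qed.

(** The tail is dominated term by term by that of B e^{C|t|}. The bound is proportional to [B], with
    a factor shared by all sequences of rate [C]: when [B] is a site-dependent weight, the tails can
    be summed over the sites. *)
Lemma egf_tail B C g t N : 0 <= C -> exp_bounded B C g ->
  `|egf g t - pseries (fun k => g k / k`!%:R) t N|
    <= B * (expR (C * `|t|) - series (exp_coeff (C * `|t|)) N).
Proof.
move=> C0 gB.
set s := pseries _ t; set e := series _.
have cs : (fun n => `|s n - s N|) @ \oo --> `|egf g t - s N|.
  by apply: cvg_norm; apply: cvgB; [exact: cvg_egf C0 gB|exact: cvg_cst].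
have ce : (fun n => B * (e n - e N)) @ \oo --> B * (expR (C * `|t|) - e N).
  apply: cvgMr; apply: cvgB; last exact: cvg_cst.
  exact: is_cvg_series_exp_coeff.
rewrite -(cvg_lim _ cs)// -(cvg_lim _ ce)//.
apply: ler_lim; [by apply/cvg_ex; exists (`|egf g t - s N|)|by apply/cvg_ex; eexists; exact: ce|].
near=> n.
have Nn : (N <= n)%N by near: n; exact: nbhs_infty_ge.
rewrite /s /e /pseries !sub_series_geq// mulr_sumr.
apply: le_trans (ler_norm_sum _ _ _) _.
by apply: ler_sum => k _; exact: exp_bounded_term.
Unshelve. all: by end_near. Qed.

Lemma egf_le B C g t : 0 <= C -> exp_bounded B C g ->
  `|egf g t| <= B * expR (C * `|t|).
Proof.
move=> C0 gB; have := egf_tail t 0 C0 gB.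
by rewrite /pseries /series/= !big_geq// !subr0.
Qed.

Lemma egf0 g : egf g 0 = g 0%N.
Proof.
apply: lim_near_cst => //; near=> n.
rewrite -[n]prednK; last by near: n; exact: nbhs_infty_gt.
rewrite /pseries /series/= big_nat_recl//= fact0 divr1 expr0 mulr1.
by rewrite big1 ?addr0// => i _; rewrite exprS mul0r mulr0.
Unshelve. all: by end_near. Qed.

Lemma exp_bounded_shift B C g : exp_bounded B C g ->
  exp_bounded (B * C) C (fun k => g k.+1).
Proof. by move=> gB k; rewrite -mulrA -exprS. Qed.

Lemma pseries_diffs_egf g :
  pseries_diffs (fun k => g k / k`!%:R) = (fun k => g k.+1 / k`!%:R).
Proof.
apply/funext => k; rewrite /pseries_diffs factS natrM.
have k1 : k.+1%:R != 0 :> R by rewrite pnatr_eq0.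
have kf : k`!%:R != 0 :> R by rewrite pnatr_eq0 -lt0n fact_gt0.
by rewrite mulrCA invfM mulVKf.
Qed.

Lemma is_derive_egf B C g t : 0 <= C -> exp_bounded B C g ->
  is_derive t (1 : R) (egf g) (egf (fun k => g k.+1) t).
Proof.
move=> C0 gB.
have sB := exp_bounded_shift gB; have ssB := exp_bounded_shift sB.
rewrite [X in is_derive _ _ _ X](_ : _ =
  limn (pseries (pseries_diffs (fun k => g k / k`!%:R)) t)); last first.
  by rewrite pseries_diffs_egf.
(* Termwise differentiation asks for convergence of the series and of its first two formal
   derivatives at a point beyond |t|. They converge everywhere, so |t| + 1 will do. *)
apply: (@pseries_snd_diffs _ (fun k => g k / k`!%:R) (`|t| + 1)).
- by apply: cvgP; exact: (cvg_egf C0 gB).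
- rewrite pseries_diffs_egf; by apply: cvgP; exact: (cvg_egf C0 sB).
- rewrite pseries_diffs_egf (pseries_diffs_egf (fun k => g k.+1)).
  by apply: cvgP; exact: (cvg_egf C0 ssB).
- by rewrite [ltRHS]ger0_norm// ltrDl.
Qed.

Lemma egf_lin3 B1 B2 B3 C g1 g2 g3 a1 a2 a3 t : 0 <= C ->
  exp_bounded B1 C g1 -> exp_bounded B2 C g2 -> exp_bounded B3 C g3 ->
  egf (fun k => a1 * g1 k + a2 * g2 k + a3 * g3 k) t =
  a1 * egf g1 t + a2 * egf g2 t + a3 * egf g3 t.
Proof.
move=> C0 b1 b2 b3; apply: cvg_lim => //.
have -> : pseries (fun k => (a1 * g1 k + a2 * g2 k + a3 * g3 k) / k`!%:R) t =
  (fun n => a1 * pseries (fun k => g1 k / k`!%:R) t n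
         + a2 * pseries (fun k => g2 k / k`!%:R) t n
         + a3 * pseries (fun k => g3 k / k`!%:R) t n).
  apply/funext => n; rewrite /pseries /series/= !mulr_sumr -!big_split/=.
  by apply: eq_bigr => k _; ring.
apply: cvgD; [apply: cvgD|]; apply: cvgMr; [exact: cvg_egf b1|exact: cvg_egf b2|exact: cvg_egf b3].
Qed.

End ExponentialGeneratingFunction.

(** * Jacobi operators on the integers *)

Section JacobiOperator.
Variable R : realType.
Implicit Types (c V f g : int -> R) (m n : int).

(** [c n] is the weight of the bond between [n] and [n + 1], used in both directions, so the
    operator is symmetric. Variable weights put the full line and the decoupled half-line under one
    definition. *)
Definition jacobi c V f : int -> R :=
  fun n => c n * f (n + 1) + c (n - 1) * f (n - 1) + V n * f n.

(* Matrix element [<delta_n, J^k delta_m>] of [J = jacobi c V]. *)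
Definition jacobi_moment c V m k n : R :=
  iter k (jacobi c V) (fun l => (l == m)%:R) n.

Definition re_powNi k : R := complex.Re ((- 'i%C) ^+ k : R[i]).
Definition im_powNi k : R := complex.Im ((- 'i%C) ^+ k : R[i]).

Lemma powNiE k : (- 'i%C) ^+ k = Complex (re_powNi k) (im_powNi k) :> R[i].
Proof. by rewrite /re_powNi /im_powNi; case: (_ ^+ k). Qed.

Lemma re_powNiS k : re_powNi k.+1 = im_powNi k.
Proof. by rewrite {1}/re_powNi exprS powNiE /=; ring. Qed.

Lemma im_powNiS k : im_powNi k.+1 = - re_powNi k.
Proof. by rewrite {1}/im_powNi exprS powNiE /=; ring. Qed.

Lemma powNi_le1 k : `|re_powNi k| <= 1 /\ `|im_powNi k| <= 1.
Proof.
elim: k => [|k [IHr IHi]].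
  by rewrite /re_powNi /im_powNi expr0 /= normr1 normr0.
by rewrite re_powNiS im_powNiS normrN.
Qed.

(** Real and imaginary parts of the matrix element of e^{-itJ} between sites [n] and [m]. The
    moments are real, so only the powers of -i need splitting. *)
Definition jacobi_re c V m n : R -> R :=
  egf (fun k => re_powNi k * jacobi_moment c V m k n).
Definition jacobi_im c V m n : R -> R :=
  egf (fun k => im_powNi k * jacobi_moment c V m k n).

(** The base 1/2 is a convenience: what matters is that neighbouring weights are comparable and that
    the squares are summable. *)
Definition decay n : R := 2^-1 ^+ `|n|%N.

Lemma decay_ge0 n : 0 <= decay n.
Proof. by rewrite exprn_ge0// invr_ge0. Qed.

Lemma decay_le2 n n' : (`|n|%N <= `|n'|%N.+1)%N -> decay n' <= 2 * decay n.
Proof.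
move=> nn'; rewrite -ler_pdivrMl// -exprS.
by rewrite ler_wiXn2l// ?invr_ge0// invf_le1// ler1n.
Qed.

Lemma iter_jacobi_lin c V f1 f2 f3 (a1 a2 a3 : R) k n :
  iter k (jacobi c V) (fun n => a1 * f1 n + a2 * f2 n + a3 * f3 n) n =
  a1 * iter k (jacobi c V) f1 n + a2 * iter k (jacobi c V) f2 n
    + a3 * iter k (jacobi c V) f3 n.
Proof.
elim: k n => // k IH n; rewrite !iterS {1}/jacobi !IH /jacobi; ring.
Qed.

Lemma jacobi_momentS c V m k n :
  jacobi_moment c V m k.+1 n = jacobi c V (jacobi_moment c V m k) n.
Proof. by []. Qed.

Lemma jacobi_delta c V m :
  jacobi c V (fun l => (l == m)%:R) =
  (fun l => c m * (l == m + 1)%:R + c (m - 1) * (l == m - 1)%:R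
     + V m * (l == m)%:R).
Proof.
apply/funext => l; rewrite /jacobi [X in X + _]addrC; congr (_ + _ + _).
- rewrite -subr_eq; have [<-|] := eqVneq; last by rewrite !mulr0.
  by rewrite ?subr_eq.
- rewrite eq_sym -subr_eq eq_sym; have [->|] := eqVneq; last by rewrite !mulr0.
  by [].
- by have [->|] := eqVneq l m; last by rewrite !mulr0.
Qed.

(** One side applies J last and reads off row [n]; the other applies J first, to the delta at [n].
    Both give the same three coefficients, and the induction hypothesis matches the terms. *)
Lemma jacobi_moment_sym c V m k n :
  jacobi_moment c V m k n = jacobi_moment c V n k m.
Proof.
elim: k m n => [|k IH] m n; first by rewrite /jacobi_moment /= eq_sym.
rewrite jacobi_momentS /jacobi_moment iterSr jacobi_delta iter_jacobi_lin.
by rewrite /jacobi; congr (_ * _ + _ * _ + _ * _); exact: IH.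
Qed.

Lemma jacobi_re_sym c V m n : jacobi_re c V m n = jacobi_re c V n m.
Proof.
by rewrite /jacobi_re; congr egf; apply/funext => k; rewrite jacobi_moment_sym.
Qed.

Lemma jacobi_im_sym c V m n : jacobi_im c V m n = jacobi_im c V n m.
Proof.
by rewrite /jacobi_im; congr egf; apply/funext => k; rewrite jacobi_moment_sym.
Qed.

Lemma jacobi_re0 c V m n : jacobi_re c V m n 0 = (n == m)%:R.
Proof. by rewrite /jacobi_re egf0 /re_powNi /= mul1r. Qed.

Lemma jacobi_im0 c V m n : jacobi_im c V m n 0 = 0.
Proof. by rewrite /jacobi_im egf0 /im_powNi /= mul0r. Qed.

(** * Localisation bounds and equations of motion for bounded coefficients *)

Section Bounded.
Variables (c V : int -> R) (M : R).
Hypotheses (c1 : forall n, `|c n| <= 1) (VM : forall n, `|V n| <= M).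

Let C := 4 + M.

Let C_ge0 : 0 <= C.
Proof. by rewrite addr_ge0// (le_trans _ (VM 0)). Qed.

(** A step to a neighbour changes [decay] by a factor of at most 2, so each of the two bonds
    contributes 2 and the potential contributes [M]; hence the rate 4 + M per application. *)
Lemma jacobi_moment_le m k n :
  `|jacobi_moment c V m k n| <= decay (n - m) * C ^+ k.
Proof.
elim: k n => [|k IH] n.
  rewrite expr0 mulr1 /jacobi_moment /= ger0_norm//.
  by have [->|_] := eqVneq; rewrite ?decay_ge0// subrr /decay expr0.
have bnd n' : (`|(n - m)|%N <= `|n' - m|%N.+1)%N ->
    forall a, `|a| <= 1 ->
    `|a * jacobi_moment c V m k n'| <= 2 * (decay (n - m) * C ^+ k).
  move=> nn' a a1; rewrite normrM -[leRHS]mul1r ler_pM// (le_trans (IH _))//.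
  by rewrite mulrA ler_wpM2r ?exprn_ge0// decay_le2.
have Vb : `|V n * jacobi_moment c V m k n| <= M * (decay (n - m) * C ^+ k).
  by rewrite normrM ler_pM.
rewrite jacobi_momentS /jacobi.
apply: (le_trans (ler_normD _ _)); apply: le_trans (lerD (ler_normD _ _) Vb) _.
have b1 := bnd (n + 1) _ _ (c1 n); have b2 := bnd (n - 1) _ _ (c1 (n - 1)).
apply: le_trans (lerD (lerD (b1 _) (b2 _)) (lexx _)) _; [lia|lia|].
rewrite le_eqVlt; apply/orP; left; apply/eqP; rewrite exprS /C; ring.
Qed.

Lemma re_moment_bounded m n :
  exp_bounded (decay (n - m)) C (fun k => re_powNi k * jacobi_moment c V m k n).
Proof.
move=> k; rewrite normrM -[leRHS]mul1r ler_pM ?jacobi_moment_le//.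
by have [] := powNi_le1 k.
Qed.

Lemma im_moment_bounded m n :
  exp_bounded (decay (n - m)) C (fun k => im_powNi k * jacobi_moment c V m k n).
Proof.
move=> k; rewrite normrM -[leRHS]mul1r ler_pM ?jacobi_moment_le//.
by have [] := powNi_le1 k.
Qed.

Lemma jacobi_re_le m n t : `|jacobi_re c V m n t| <= decay (n - m) * expR (C * `|t|).
Proof. exact: egf_le (re_moment_bounded m n). Qed.

Lemma jacobi_im_le m n t : `|jacobi_im c V m n t| <= decay (n - m) * expR (C * `|t|).
Proof. exact: egf_le (im_moment_bounded m n). Qed.

(* Real and imaginary parts of [i psi' = J psi]. *)
Lemma is_derive_jacobi_re m n t :
  is_derive t (1 : R) (jacobi_re c V m n)
    (jacobi c V (fun l => jacobi_im c V m l t) n).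
Proof.
rewrite /jacobi /jacobi_im -(egf_lin3 _ _ _ _ C_ge0 (im_moment_bounded m _) (im_moment_bounded m _) (im_moment_bounded m _)).
have -> : (fun k => c n * (im_powNi k * jacobi_moment c V m k (n + 1))
    + c (n - 1) * (im_powNi k * jacobi_moment c V m k (n - 1))
    + V n * (im_powNi k * jacobi_moment c V m k n)) =
  (fun k => re_powNi k.+1 * jacobi_moment c V m k.+1 n).
  by apply/funext => k; rewrite jacobi_momentS re_powNiS /jacobi; ring.
exact: is_derive_egf (re_moment_bounded m n).
Qed.

Lemma is_derive_jacobi_im m n t :
  is_derive t (1 : R) (jacobi_im c V m n)
    (- jacobi c V (fun l => jacobi_re c V m l t) n).
Proof.
rewrite [X in is_derive _ _ _ X](_ : _ =
  egf (fun k => im_powNi k.+1 * jacobi_moment c V m k.+1 n) t).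
  exact: is_derive_egf (im_moment_bounded m n).
rewrite (_ : (fun k => _) =
   (fun k => - c n * (re_powNi k * jacobi_moment c V m k (n + 1))
    + - c (n - 1) * (re_powNi k * jacobi_moment c V m k (n - 1))
    + - V n * (re_powNi k * jacobi_moment c V m k n))).
  rewrite (egf_lin3 _ _ _ _ C_ge0 (re_moment_bounded m _) (re_moment_bounded m _) (re_moment_bounded m _)).
  by rewrite /jacobi /jacobi_re; ring.
by apply/funext => k; rewrite jacobi_momentS im_powNiS /jacobi; ring.
Qed.

End Bounded.

End JacobiOperator.

(** * Real derivatives and Green's identity *)

Section RealDerivatives.
Variable R : realType.
Implicit Types (f g : R -> R) (s t : R).

Local Notation "f '#d' s '~>' l" := (is_derive (s : R) (1 : R) f (l : R))
  (at level 70, s at next level).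

Lemma is_deriveD_fun f g s (df dg : R) :
  f #d s ~> df -> g #d s ~> dg -> (fun x => f x + g x) #d s ~> (df + dg).
Proof. by move=> hf hg; exact: is_deriveD. Qed.

Lemma is_deriveM_fun f g s (df dg : R) :
  f #d s ~> df -> g #d s ~> dg ->
  (fun x => f x * g x) #d s ~> (df * g s + f s * dg).
Proof.
move=> hf hg; apply: (is_derive_eq (is_deriveM hf hg)).
by rewrite /GRing.scale/= addrC [g s * _]mulrC.
Qed.

Lemma is_deriveZ_fun f s (a df : R) :
  f #d s ~> df -> (fun x => a * f x) #d s ~> (a * df).
Proof. by move=> hf; exact: (is_deriveZ a hf). Qed.

Lemma is_derive_rev f s t (df : R) :
  f #d (t - s) ~> df -> (fun x => f (t - x)) #d s ~> (- df).
Proof.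
move=> hf.
have h : (fun x : R => t - x) #d s ~> (-1).
  apply: (is_derive_eq (is_deriveD_fun (is_derive_cst t s 1) (is_deriveN (is_derive_id s 1)))).
  by rewrite add0r.
rewrite -mulrN1; exact: (@is_derive1_comp _ f (fun x => t - x) s df (-1) hf h).

Qed.

Lemma is_derive_sum_fun (K : nat) (F : 'I_K -> R -> R) (dF : 'I_K -> R) s :
  (forall k, F k #d s ~> dF k) ->
  (fun x => \sum_(k < K) F k x) #d s ~> (\sum_(k < K) dF k).
Proof.
move=> hF; have := is_derive_sum hF.
by rewrite (_ : \sum_(k < K) F k = (fun x => \sum_(k < K) F k x))// fct_sumE.
Qed.

Lemma increment_le f (df : R -> R) t e : 0 <= t ->
  (forall s, 0 <= s <= t -> f #d s ~> df s) ->
  (forall s, 0 <= s <= t -> df s <= e) -> f t <= f 0 + e * t.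
Proof.
move=> t0 fd de.
have [s st E] : exists2 s, s \in `[0, t]%R & f t - f 0 = df s * (t - 0).
  apply: MVT_segment => //.
    move=> s; rewrite in_itv/= => /andP[s0 st]; apply: fd.
    by rewrite !ltW.
  apply: derivable_within_continuous => s; rewrite in_itv/= => /fd h.
  exact: (@ex_derive _ _ _ _ _ _ _ h).
have : df s * t <= e * t by rewrite ler_wpM2r// de// -in_itv.
by rewrite subr0 in E; lra.
Qed.

(** Removes the error made by cutting sums over sites to a finite window. *)
Lemma le_decay_lim (x y a : R) : (forall N, x <= y + a * 2^-1 ^+ N) -> x <= y.
Proof.
move=> h.
have c : (fun N => y + a * 2^-1 ^+ N) @ \oo --> y + a * 0.
  apply: cvgD; first exact: cvg_cst.
  apply: cvgMr; apply: cvg_expr; rewrite ger0_norm ?invr_ge0//.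
  by rewrite invf_lt1 ?ltr1n.
rewrite mulr0 addr0 in c; rewrite -(cvg_lim _ c)//.
by apply: limr_ge; [apply: cvgP c|near=> N; exact: h].
Unshelve. all: by end_near. Qed.

End RealDerivatives.

(** * Green's identity and the flux through a bond *)

Section Flux.
Variable R : realType.
Implicit Types (c V f g : int -> R) (a n : int).

(** The discrete Wronskian (Casoratian), weighted by the bond; it vanishes across a cut bond. *)
Definition flux c f g n : R := c n * (f n * g (n + 1) - f (n + 1) * g n).

(** The potential terms cancel, and each summand is the difference of the fluxes through the two
    bonds at its site, so the sum telescopes. *)
Lemma jacobi_green c V f g a K :
  \sum_(k < K) (f (a + k%:Z) * jacobi c V g (a + k%:Z)
                - g (a + k%:Z) * jacobi c V f (a + k%:Z))
  = flux c f g (a + K%:Z - 1) - flux c f g (a - 1).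
Proof.
elim: K => [|K IH]; first by rewrite big_ord0 addr0 subrr.
rewrite big_ord_recr /= IH.
have -> : a + K.+1%:Z - 1 = a + K%:Z by lia.
by rewrite /flux /jacobi subrK; ring.
Qed.

Lemma flux_le c f g n (A B : R) : `|c n| <= 1 ->
  `|f n| <= A -> `|f (n + 1)| <= A -> `|g n| <= B -> `|g (n + 1)| <= B ->
  `|flux c f g n| <= 2 * (A * B).
Proof.
move=> c1 fA fA' gB gB'; rewrite normrM -[leRHS]mul1r ler_pM//.
apply: le_trans (ler_normB _ _) _; rewrite !normrM mulr_natl mulr2n.
by rewrite lerD// ler_pM.
Qed.

End Flux.

(** * Unitarity and Duhamel's formula *)

Definition full_bond (R : realType) (n : int) : R := 1.
(* Removing the bond between 0 and 1 decouples the half-line n >= 1. *)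
Definition cut_bond (R : realType) (n : int) : R := (n != 0)%:R.

(* AM-GM with weight [mu], after noting that
   [(a y - b x)^2 + (a x + b y)^2 = (a^2 + b^2) (x^2 + y^2)]. *)
Lemma weighted_am_gm (R : realFieldType) (a b p q x y mu : R) :
  0 < mu -> x ^+ 2 + y ^+ 2 <= 1 ->
  a * (p * y + q * x) + b * (q * y - p * x) <=
  2^-1 * (mu * (p ^+ 2 + q ^+ 2)) + 2^-1 * (mu^-1 * (a ^+ 2 + b ^+ 2)).
Proof.
move=> mu0 xy1.
have sq u v : u * v <= 2^-1 * (mu * u ^+ 2) + 2^-1 * (mu^-1 * v ^+ 2).
  have : 0 <= 2^-1 * (mu^-1 * (mu * u - v) ^+ 2).
    by rewrite mulr_ge0// ?invr_ge0// mulr_ge0 ?sqr_ge0// invr_ge0 ltW.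
  suff -> : 2^-1 * (mu^-1 * (mu * u - v) ^+ 2) =
    2^-1 * (mu * u ^+ 2) + 2^-1 * (mu^-1 * v ^+ 2) - u * v by lra.
  by field; rewrite gt_eqF.
have s1 := sq p (a * y - b * x); have s2 := sq q (a * x + b * y).
have : mu^-1 * ((a ^+ 2 + b ^+ 2) * (x ^+ 2 + y ^+ 2)) <= mu^-1 * (a ^+ 2 + b ^+ 2).
  by rewrite ler_wpM2l ?invr_ge0 ?(ltW mu0)// ler_piMr// addr_ge0 ?sqr_ge0.
have -> : (a ^+ 2 + b ^+ 2) * (x ^+ 2 + y ^+ 2) =
  (a * y - b * x) ^+ 2 + (a * x + b * y) ^+ 2 by ring.
have -> : a * (p * y + q * x) + b * (q * y - p * x) =
  p * (a * y - b * x) + q * (a * x + b * y) by ring.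
by move: s1 s2; rewrite !mulrDr; lra.
Qed.

Section Propagation.
Variables (R : realType) (V : int -> R) (M : R).
Hypothesis VM : forall n, `|V n| <= M.

Let C := 4 + M.

Let C_ge0 : 0 <= C.
Proof. by rewrite addr_ge0// (le_trans _ (VM 0)). Qed.

Local Notation one := (full_bond R).
Local Notation cut := (cut_bond R).

Let one_le1 n : `|one n| <= 1. Proof. by rewrite normr1. Qed.

Let cut_le1 n : `|cut n| <= 1.
Proof. by rewrite /cut_bond ger0_norm// lern1 leq_b1. Qed.

Let x n := jacobi_re one V 0 n.
Let y n := jacobi_im one V 0 n.

Let E t := expR (C * t).

Let E_ge0 t : 0 <= E t. Proof. exact: expR_ge0. Qed.

Let coef_le c (c1 : forall n, `|c n| <= 1) m n (t s : R) : 0 <= s <= t ->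
  `|jacobi_re c V m n s| <= decay R (n - m) * E t /\
  `|jacobi_im c V m n s| <= decay R (n - m) * E t.
Proof.
move=> /andP[s0 st]; have le : expR (C * `|s|) <= E t.
  by rewrite ler_expR ler_wpM2l// ger0_norm.
split.
- by rewrite (le_trans (jacobi_re_le c1 VM _ _ _))// ler_wpM2l// decay_ge0.
- by rewrite (le_trans (jacobi_im_le c1 VM _ _ _))// ler_wpM2l// decay_ge0.
Qed.

Lemma decay_mono n n' : (`|n'|%N <= `|n|%N)%N -> decay R n <= decay R n'.
Proof. by move=> nn'; rewrite ler_wiXn2l// ?invr_ge0// invf_le1// ler1n. Qed.

Lemma decay_le1 n : decay R n <= 1.
Proof. by rewrite exprn_ile1// ?invr_ge0// invf_le1// ler1n. Qed.

(* The mass in the window [-N, N] changes only through the flux at its two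
   endpoints, which is exponentially small in [N]. *)
Lemma return_amplitude_le1 (t : R) : 0 <= t ->
  jacobi_re one V 0 0 t ^+ 2 + jacobi_im one V 0 0 t ^+ 2 <= 1.
Proof.
move=> t0; apply: (@le_decay_lim _ _ _ (8 * E t ^+ 2 * t)) => N.
pose site k : int := - N%:Z + k%:Z.
(* The 8 is a factor 2 from differentiating squares, times two endpoints, times the 2 in the flux
   bound. *)
pose e := 8 * (decay R N%:Z * E t ^+ 2).
pose mass s := \sum_(k < N.*2.+1) (x (site k) s * x (site k) s + y (site k) s * y (site k) s).
have flux_small n : (N <= `|n|)%N -> (N <= `|(n + 1)%R|)%N -> forall s, 0 <= s <= t ->
    `|flux one (x^~ s) (y^~ s) n| <= 2 * (decay R N%:Z * E t ^+ 2).
  move=> nN n1N s st; rewrite expr2.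
  (* One decaying factor suffices: [x] keeps its decay, while that of [y] is bounded by 1. *)
  have -> : decay R N%:Z * (E t * E t) = (decay R N%:Z * E t) * E t by ring.
  have [xn yn] := coef_le one_le1 0 n st.
  have [xn1 yn1] := coef_le one_le1 0 (n + 1) st.
  rewrite !subr0 in xn yn xn1 yn1; apply: flux_le => //.
  - by rewrite (le_trans xn)// ler_wpM2r// decay_mono.
  - by rewrite (le_trans xn1)// ler_wpM2r// decay_mono.
  - by rewrite (le_trans yn)// ler_piMl// decay_le1.
  - by rewrite (le_trans yn1)// ler_piMl// decay_le1.
have mass_t : mass t <= mass 0 + e * t.
  pose dmass s := 2 * (flux one (x^~ s) (y^~ s) (site (N.*2.+1) - 1)
                       - flux one (x^~ s) (y^~ s) (- N%:Z - 1)).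
  apply: (@increment_le _ mass dmass t e t0) => s st.
    rewrite /dmass -(jacobi_green _ V) mulr_sumr.
    apply: is_derive_sum_fun => k.
    have dx := is_derive_jacobi_re one_le1 VM 0 (site k) s.
    have dy := is_derive_jacobi_im one_le1 VM 0 (site k) s.
    apply: (is_derive_eq (is_deriveD_fun (is_deriveM_fun dx dx) (is_deriveM_fun dy dy))).
    by rewrite /x /y /site; ring.
  have f1 := flux_small (site (N.*2.+1) - 1) _ _ s st.
  have f2 := flux_small (- N%:Z - 1) _ _ s st.
  have {}f1 := f1 ltac:(rewrite /site; lia) ltac:(rewrite /site; lia).
  have {}f2 := f2 ltac:(lia) ltac:(lia).
  rewrite /dmass /e; move: f1 f2; rewrite !ler_norml; lra.
have mass0 : mass 0 = 1.
  (* Index [N] of the window is site 0, which carries all the initial mass. *)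
  have N2 : (N < N.*2.+1)%N by lia.
  rewrite /mass (bigD1 (Ordinal N2))//= big1 ?addr0.
    by rewrite /x /y jacobi_re0 jacobi_im0 /site addNr eqxx mulr1 mulr0 addr0.
  move=> k /eqP kN; rewrite /x /y jacobi_re0 jacobi_im0.
  have -> : (site k == 0) = false.
    by apply/eqP => k0; apply: kN; apply/val_inj; move: k0; rewrite /site/=; lia.
  by rewrite !mulr0 addr0.
have mass_ge : x 0 t ^+ 2 + y 0 t ^+ 2 <= mass t.
  have N2 : (N < N.*2.+1)%N by lia.
  rewrite /mass (bigD1 (Ordinal N2))//= /site addNr !expr2 lerDl.
  by apply: sumr_ge0 => k _; rewrite addr_ge0// -expr2 sqr_ge0.
apply: (le_trans mass_ge); rewrite (le_trans mass_t)// mass0 lerD2l /e /decay /=.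
by rewrite le_eqVlt; apply/orP; left; apply/eqP; ring.
Qed.

(* Duhamel's formula in dual form: pairing the full-line solution with the
   time-reversed half-line solution started at [j.+1] telescopes, so only the
   source term at site 1 contributes. *)
Lemma duhamel_bound (T : R) (K : R -> R) (j : nat) (t : R) :
  0 < T -> 0 <= t -> K 0 = 0 ->
  (forall r : R, 0 <= r -> is_derive r (1 : R) K (expR (- (r / T)) *
     (jacobi_re cut V 1 j.+1%:Z r ^+ 2 + jacobi_im cut V 1 j.+1%:Z r ^+ 2))) ->
  jacobi_re one V 0 j.+1%:Z t ^+ 2 + jacobi_im one V 0 j.+1%:Z t ^+ 2
    <= T * expR (t / T) * K t.
Proof.
move=> T0 t0 K0 dK.
pose p n := jacobi_re cut V j.+1%:Z n; pose q n := jacobi_im cut V j.+1%:Z n.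
pose a := x j.+1%:Z t; pose b := y j.+1%:Z t; pose Z := a ^+ 2 + b ^+ 2.
have Z0 : 0 <= Z by rewrite addr_ge0 ?sqr_ge0.
(* AM-GM with weight [lam * w (t - s)] costs half of [Z / lam * W (t - s)]. Integrated over s in
   [0, t] this is at most Z T e^{t/T} / (2 lam), and this [lam] makes it Z / 2, which the left-hand
   side absorbs. *)
pose lam := T * expR (t / T).
have lam0 : 0 < lam by rewrite mulr_gt0 ?expR_gt0.
pose w r := expR (- (r / T)).
pose W r := expR (r / T).
have wW r : w r * W r = 1 by rewrite /w /W mulrC expRxMexpNx_1.
suff : Z <= 2^-1 * (lam * K t) + 2^-1 * Z.
  by rewrite -/a -/b -/Z -/lam; lra.
apply: (@le_decay_lim _ _ _ (4 * (`|a| + `|b|) * E t ^+ 2 * t)) => N.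
(* The window of sites 1, ..., L contains j + 1 and reaches beyond N. *)
pose L := (j + N).+1.
pose site k : int := 1 + k%:Z.
(* The real part of the conjugate of a + ib times the sum over the window of (p + iq)(t - s) (x +
   iy)(s). It is 0 at s = 0 and [Z] at s = t. *)
pose pairing s := \sum_(k < L)
  (a * (p (site k) (t - s) * x (site k) s - q (site k) (t - s) * y (site k) s)
   + b * (p (site k) (t - s) * y (site k) s + q (site k) (t - s) * x (site k) s)).
(* The added terms decrease exactly at the rate of the two AM-GM costs of [source], so [D] can grow
   only through the fluxes at [L], at rate at most [e]. *)
pose D s := pairing s
  + (2^-1 * lam * K (t - s) + 2^-1 * (Z / lam) * T * W (t - s)).
pose fl f g n s := flux cut (f^~ (t - s)) (g^~ s) n.
pose source s := a * (p 1 (t - s) * y 0 s + q 1 (t - s) * x 0 s)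
                 + b * (q 1 (t - s) * y 0 s - p 1 (t - s) * x 0 s).
pose total s := a * (fl p y L%:Z s + fl q x L%:Z s)
                + b * (fl q y L%:Z s - fl p x L%:Z s) + source s.
pose dD s := total s - (2^-1 * lam * (w (t - s) * (p 1 (t - s) ^+ 2 + q 1 (t - s) ^+ 2))
   + 2^-1 * (Z / lam) * W (t - s)).
pose e : R := 4 * (`|a| + `|b|) * (decay R N%:Z * E t ^+ 2).
have dpairing (s : R) : is_derive s (1 : R) pairing (total s).
  (* The bond between 0 and 1 is cut, so no flux enters at the left end of the window; only the bond
     from [L] to [L + 1] remains. *)
  have green (f g : int -> R -> R) : flux cut (f^~ (t - s)) (g^~ s) L%:Z =
    \sum_(k < L) (f (site k) (t - s) * jacobi cut V (g^~ s) (site k)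
                - g (site k) s * jacobi cut V (f^~ (t - s)) (site k)).
    rewrite jacobi_green subrr {3}/flux {3}/cut_bond eqxx mul0r subr0.
    by congr flux; lia.
  have src (u : R) (g : nat -> R) : \sum_(k < L) (nat_of_ord k == 0%N)%:R * (u * g k) = u * g 0%N :> R.
    rewrite (bigD1 (@Ordinal L 0%N isT))//= mul1r big1 ?addr0// => k /eqP k0.
    case: eqP => [k0'|]; last by rewrite mul0r.
    by exfalso; apply: k0; apply/val_inj.
  (* On the sites n >= 1 the two operators differ only by the restored bond, which feeds [f 0] into
     site 1: this is Duhamel's source. *)
  have full (f : int -> R) (k : nat) : jacobi one V f (site k) =
      jacobi cut V f (site k) + (k == 0%N)%:R * f 0.
    rewrite /jacobi /full_bond /cut_bond /site.
    case: k => [|k]; first by rewrite addr0 subrr eqxx /=; ring.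
    have -> : (1 + k.+1%:Z != 0) by lia.
    by rewrite /=; ring.
  have -> : total s = \sum_(k < L)
    (a * (p (site k) (t - s) * (jacobi cut V (y^~ s) (site k) + (nat_of_ord k == 0%N)%:R * y 0 s)
         - y (site k) s * jacobi cut V (p^~ (t - s)) (site k)
         + (q (site k) (t - s) * (jacobi cut V (x^~ s) (site k) + (nat_of_ord k == 0%N)%:R * x 0 s)
         - x (site k) s * jacobi cut V (q^~ (t - s)) (site k)))
    + b * (q (site k) (t - s) * (jacobi cut V (y^~ s) (site k) + (nat_of_ord k == 0%N)%:R * y 0 s)
         - y (site k) s * jacobi cut V (q^~ (t - s)) (site k)
         - (p (site k) (t - s) * (jacobi cut V (x^~ s) (site k) + (nat_of_ord k == 0%N)%:R * x 0 s)
         - x (site k) s * jacobi cut V (p^~ (t - s)) (site k)))).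
    rewrite /total /source /fl !green.
    have s1 := src 1 (fun k => a * (p (site k) (t - s) * y 0 s + q (site k) (t - s) * x 0 s)
                 + b * (q (site k) (t - s) * y 0 s - p (site k) (t - s) * x 0 s)).
    have site00 : site 0%N = 1 by rewrite /site addr0.
    rewrite /= site00 [RHS]mul1r in s1.
    rewrite -[X in _ + X]s1 -!big_split -sumrB !mulr_sumr -!big_split/=.
    by apply: eq_bigr => k _; ring.
  apply: is_derive_sum_fun => k.
  have dx := is_derive_jacobi_re one_le1 VM 0 (site k) s.
  have dy := is_derive_jacobi_im one_le1 VM 0 (site k) s.
  have dp := is_derive_rev (is_derive_jacobi_re cut_le1 VM j.+1%:Z (site k) (t - s)).
  have dq := is_derive_rev (is_derive_jacobi_im cut_le1 VM j.+1%:Z (site k) (t - s)).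
  rewrite full in dx; rewrite full in dy.
  have dre := is_deriveD_fun (is_deriveM_fun dp dx)
    (is_deriveZ_fun (-1) (is_deriveM_fun dq dy)).
  have dim := is_deriveD_fun (is_deriveM_fun dp dy) (is_deriveM_fun dq dx).
  have := is_deriveD_fun (is_deriveZ_fun a dre) (is_deriveZ_fun b dim).
  rewrite [X in is_derive _ _ X _ -> _](_ : _ = (fun x0 => a *
     (p (site k) (t - x0) * x (site k) x0 - q (site k) (t - x0) * y (site k) x0) +
     b * (p (site k) (t - x0) * y (site k) x0 + q (site k) (t - x0) * x (site k) x0))).
    by move=> h; apply: (is_derive_eq h); rewrite /x /y /p /q; ring.
  by apply/funext => r; rewrite /x /y /p /q; ring.
have dDs (s : R) : 0 <= s <= t -> is_derive s (1 : R) D (dD s).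
  move=> /andP[s0 st]; have ts : 0 <= t - s by rewrite subr_ge0.
  have dW : is_derive (t - s) (1 : R) W (T^-1 * W (t - s)).
    have h : is_derive (t - s) (1 : R) (fun r => T^-1 * r) (T^-1 * 1).
      exact: is_deriveZ_fun.
    have := @is_derive1_comp _ expR (fun r => T^-1 * r) (t - s) _ _ (is_derive_expR _) h.
    rewrite (_ : expR \o _ = W); last by apply/funext => r; rewrite /W/= mulrC.
    by move=> h'; apply: (is_derive_eq h'); rewrite /W mulr1 mulrC [_ / T]mulrC.
  have h := is_deriveD_fun (dpairing s) (is_deriveD_fun
     (is_deriveZ_fun (2^-1 * lam) (is_derive_rev (dK _ ts)))
     (is_deriveZ_fun (2^-1 * (Z / lam) * T) (is_derive_rev dW))).
  apply: (is_derive_eq h); rewrite /dD /p /q /w.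
  (* [K] involves the solution started at 1 and seen at j + 1, the pairing the one started at j + 1
     and seen at 1; symmetry of the propagator identifies them. *)
  rewrite (jacobi_re_sym _ _ j.+1%:Z 1) (jacobi_im_sym _ _ j.+1%:Z 1).
  have TT : T * T^-1 = 1 by rewrite mulfV// gt_eqF.
  rewrite mulrN [2^-1 * (Z / lam) * T * - _]mulrN (mulrA _ T^-1) -(mulrA _ T) TT mulr1.
  by rewrite opprD addrA.
have dDe (s : R) : 0 <= s <= t -> dD s <= e.
  move=> st.
  have ts : 0 <= t - s <= t by move: st; lra.
  have LN : decay R L%:Z <= decay R N%:Z.
    by apply: decay_mono; rewrite leqW// leq_addl.
  have LN1 : decay R (L%:Z + 1) <= decay R N%:Z.
    by apply: decay_mono; rewrite -PoszD /= addn1 !leqW// leq_addl.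
  (* The decay is taken from [x] and [y], started at site 0; for [p] and [q] the plain bound [E t]
     is enough. *)
  have fle f g : (forall n, `|f n (t - s)| <= E t) ->
      (forall n, `|g n s| <= decay R n * E t) ->
      `|fl f g L%:Z s| <= 2 * (decay R N%:Z * E t ^+ 2).
    move=> fE gE.
    have -> : decay R N%:Z * E t ^+ 2 = E t * (decay R N%:Z * E t) by ring.
    apply: flux_le => //; apply: (le_trans (gE _)); rewrite ler_wpM2r//.
  have px n : `|p n (t - s)| <= E t.
    have [h _] := coef_le cut_le1 j.+1%:Z n ts.
    by rewrite (le_trans h)// ler_piMl// decay_le1.
  have qx n : `|q n (t - s)| <= E t.
    have [_ h] := coef_le cut_le1 j.+1%:Z n ts.
    by rewrite (le_trans h)// ler_piMl// decay_le1.
  have xx n : `|x n s| <= decay R n * E t.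
    by have [h _] := coef_le one_le1 0 n st; rewrite subr0 in h.
  have yx n : `|y n s| <= decay R n * E t.
    by have [_ h] := coef_le one_le1 0 n st; rewrite subr0 in h.
  have f1 := fle p y px yx; have f2 := fle q x qx xx.
  have f3 := fle q y qx yx; have f4 := fle p x px xx.
  set B := 2 * _ in f1 f2 f3 f4.
  have fa : a * (fl p y L%:Z s + fl q x L%:Z s) <= `|a| * (2 * B).
    apply: (le_trans (ler_norm _)); rewrite normrM ler_wpM2l//.
    by apply: (le_trans (ler_normD _ _)); move: f1 f2; lra.
  have fb : b * (fl q y L%:Z s - fl p x L%:Z s) <= `|b| * (2 * B).
    apply: (le_trans (ler_norm _)); rewrite normrM ler_wpM2l//.
    by apply: (le_trans (ler_normB _ _)); move: f3 f4; lra.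
  have src : source s <= 2^-1 * lam * (w (t - s) * (p 1 (t - s) ^+ 2 + q 1 (t - s) ^+ 2))
      + 2^-1 * (Z / lam) * W (t - s).
    have amp : x 0 s ^+ 2 + y 0 s ^+ 2 <= 1.
      by apply: return_amplitude_le1; move: st => /andP[].
    pose mu := lam * w (t - s).
    have w0 : 0 < w (t - s) by exact: expR_gt0.
    have mu0 : 0 < mu by rewrite mulr_gt0.
    have ZE : Z / lam * W (t - s) = mu^-1 * Z.
      have -> : W (t - s) = (w (t - s))^-1.
        by apply: (mulfI (lt0r_neq0 w0)); rewrite wW mulfV// gt_eqF.
      by rewrite [RHS]mulrC /mu (invfM lam) mulrA.
    have -> : 2^-1 * lam * (w (t - s) * (p 1 (t - s) ^+ 2 + q 1 (t - s) ^+ 2)) =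
      2^-1 * (mu * (p 1 (t - s) ^+ 2 + q 1 (t - s) ^+ 2)) by rewrite /mu; ring.
    rewrite -(mulrA 2^-1 (Z / lam)) ZE.
    exact: weighted_am_gm.
  have -> : e = `|a| * (2 * B) + `|b| * (2 * B) by rewrite /e /B; ring.
  by rewrite /dD /total; lra.
have site_inj (k : 'I_L) : (site k == j.+1%:Z) = (nat_of_ord k == j).
  by rewrite /site; apply/eqP/eqP; lia.
have site0 (k : 'I_L) : (site k == 0) = false.
  by rewrite /site; apply/eqP; lia.
have D0 : D 0 = 2^-1 * (lam * K t) + 2^-1 * Z.
  rewrite /D /pairing big1 => [|k _]; last first.
    by rewrite /x /y jacobi_re0 jacobi_im0 site0 !mulr0 subrr addr0 !mulr0 addr0.
  have -> : 2^-1 * (Z / lam) * T * W (t - 0) = 2^-1 * (Z / lam * lam).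
    by rewrite subr0 /lam /W; ring.
  by rewrite divfK ?gt_eqF// subr0 add0r -(mulrA 2^-1 lam).
have Dt : D t = Z + 2^-1 * (Z / lam) * T.
  rewrite /D subrr K0 /W mul0r expR0 mulr1 mulr0 add0r; congr (_ + _).
  have jL : (j < L)%N by rewrite /L; lia.
  rewrite /pairing (bigD1 (Ordinal jL))//= big1 => [|k kj]; last first.
    rewrite subrr /p /q jacobi_re0 jacobi_im0 site_inj.
    by rewrite -(inj_eq val_inj)/= in kj; rewrite (negPf kj) !mul0r subrr addr0 !mulr0 addr0.
  rewrite subrr /p /q jacobi_re0 jacobi_im0 addr0.
  have -> : site j = j.+1%:Z by rewrite /site; lia.
  by rewrite eqxx !mul1r !mul0r subr0 addr0 /Z !expr2.
(* [D t] exceeds [Z] by this term, which is simply dropped. *)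
have ZT : 0 <= 2^-1 * (Z / lam) * T.
  by rewrite !mulr_ge0// ?invr_ge0// ltW.
have := increment_le t0 dDs dDe; rewrite D0 Dt.
have -> : e * t = 4 * (`|a| + `|b|) * E t ^+ 2 * t * 2^-1 ^+ N.
  by rewrite /e /decay/=; ring.
by lra.
Qed.

End Propagation.

(** * Laplace-weighted integrals *)

Section LaplaceWeight.
Variable R : realType.
Implicit Types (f h : R -> R).

Local Notation mu := (@lebesgue_measure R).

Lemma continuous_primitive f : continuous f -> exists F : R -> R,
  [/\ F 0 = 0, forall r : R, 0 <= r -> is_derive r (1 : R) F (f r) &
      forall X : R, 0 < X -> (\int[mu]_(x in `[0%R, X]) (f x)%:E)%E = (F X)%:E].
Proof.
move=> cf.
(* The base point -1 makes 0 an interior point, so that the primitive has a two-sided derivative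
   there. *)
pose G x := (\int[mu]_(t in `[-1, x]) f t)%R.
have intf u : mu.-integrable `[-1, u] (EFin \o f).
  apply: continuous_compact_integrable; first exact: segment_compact.
  exact: continuous_subspaceT.
have dG (r : R) : 0 <= r -> is_derive r (1 : R) G (f r).
  move=> r0; have [|||dGr G'r] := @continuous_FTC1_closed _ f (-1) r (r + 1) _ (intf _).
  - by rewrite ltrDl.
  - by rewrite (lt_le_trans _ r0)// oppr_lt0.
  - exact: cf.
  - by apply: (DeriveDef dGr); rewrite -derive1E.
have dF (r : R) : 0 <= r -> is_derive r (1 : R) (fun x => G x + - G 0) (f r).
  move=> r0; rewrite -[f r]addr0; by apply: is_deriveD_fun; exact: dG.
exists (fun x => G x + - G 0); split => //; first by rewrite subrr.
move=> X X0.
have cF (x : R) : 0 <= x -> {for x, continuous (fun x => G x + - G 0)}.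
  move=> x0; apply: differentiable_continuous; apply/derivable1_diffP.
  exact: (@ex_derive _ _ _ _ _ _ _ (dF _ x0)).
rewrite (@continuous_FTC2 _ f (fun x => G x + - G 0))//.
- by rewrite subrr -EFinB subr0.
- exact: continuous_subspaceT.
- split.
  + move=> x; rewrite in_itv/= => /andP[/ltW /dF h _].
    exact: (@ex_derive _ _ _ _ _ _ _ h).
  + by apply: cvg_at_right_filter; exact: cF.
  + by apply: cvg_at_left_filter; apply: cF; exact: ltW.
- move=> x; rewrite in_itv/= => /andP[/ltW /dF h _].
  by rewrite derive1E; exact: derive_val.
Qed.

(** Weighting the pointwise bound by e^{-2t/T} leaves T e^{-t/T} K(t). Integration by parts turns
    its integral into T^2 times that of h e^{-2t/T}, minus a boundary term that is nonnegative
    because [K] is. *)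
Lemma laplace_weight_le (T : R) f h : 0 < T ->
  continuous f -> continuous h -> (forall t, 0 <= f t) -> (forall t, 0 <= h t) ->
  (forall (K : R -> R) (t : R), K 0 = 0 ->
     (forall r : R, 0 <= r -> is_derive r (1 : R) K (expR (- (r / T)) * h r)) ->
     0 <= t -> f t <= T * expR (t / T) * K t) ->
  (\int[mu]_(t in `[0%R, +oo[) (f t * expR (- (2 * t / T)))%:E <=
   (T ^+ 2)%:E * \int[mu]_(t in `[0%R, +oo[) (h t * expR (- (2 * t / T)))%:E)%E.
Proof.
move=> T0 cf ch f0 h0 fK.
have cw (a : R) : continuous (fun t : R => expR (- (a * t / T))).
  move=> t; apply: (@continuous_comp _ _ _ (fun t => - (a * t / T)) expR).
    apply: continuousN; apply: continuousM; last exact: cst_continuous.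
    by apply: continuousM; [exact: cst_continuous|exact: cvg_id].
  exact: continuous_expR.
have cwt (g : R -> R) (a : R) : continuous g -> continuous (fun t : R => g t * expR (- (a * t / T))).
  by move=> cg t; apply: cvgM; [exact: cg|exact: cw].
have [Pf [Pf0 dPf If]] := continuous_primitive (cwt f 2 cf).
have [Ph [Ph0 dPh Ih]] := continuous_primitive (cwt h 2 ch).
have [K [K0 dK' _]] := continuous_primitive (cwt h 1 ch).
have dK (r : R) : 0 <= r -> is_derive r (1 : R) K (expR (- (r / T)) * h r).
  by move=> /dK'; rewrite mul1r mulrC.
have K_ge0 (t : R) : 0 <= t -> 0 <= K t.
  move=> t0; have := @increment_le _ (fun x => (-1) * K x)
    (fun r => (-1) * (expR (- (r / T)) * h r)) t 0 t0.
  rewrite K0 mulr0 mul0r addr0 mulN1r oppr_le0; apply.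
    by move=> s /andP[s0 _]; apply: is_deriveZ_fun; exact: dK.
  by move=> s _; rewrite mulN1r oppr_le0 mulr_ge0 ?expR_ge0.
have w2 (t : R) : expR (- (2 * t / T)) = expR (- (t / T)) * expR (- (t / T)).
  by rewrite -expRD; congr expR; ring.
have PfPh (t : R) : 0 <= t -> Pf t <= T ^+ 2 * Ph t.
  move=> t0.
  have dw (r : R) : is_derive r (1 : R) (fun r => expR (- (r / T))) (expR (- (r / T)) * - T^-1).
    have h1 : is_derive r (1 : R) (fun r => - T^-1 * r) (- T^-1 * 1).
      exact: is_deriveZ_fun.
    have := @is_derive1_comp _ expR (fun r => - T^-1 * r) r _ _ (is_derive_expR _) h1.
    rewrite (_ : expR \o _ = (fun r => expR (- (r / T)))); last first.
      by apply/funext => x; rewrite /= mulNr mulrC.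
    by move=> h2; apply: (is_derive_eq h2); rewrite mulr1 mulNr [T^-1 * _]mulrC.
  (* The integration by parts is phrased as monotonicity: [Q] vanishes at 0 and its derivative is f
     e^{-2s/T} - T e^{-s/T} K, which is at most 0 by hypothesis. *)
  pose Q s := Pf s + ((- T ^+ 2) * Ph s + T ^+ 2 * (expR (- (s / T)) * K s)).
  pose dQ s := f s * expR (- (2 * s / T)) + ((- T ^+ 2) * (h s * expR (- (2 * s / T)))
    + T ^+ 2 * (expR (- (s / T)) * - T^-1 * K s + expR (- (s / T)) * (expR (- (s / T)) * h s))).
  have dQs (s : R) : 0 <= s <= t -> is_derive s (1 : R) Q (dQ s).
    move=> /andP[s0 _].
    exact: (is_deriveD_fun (dPf s s0) (is_deriveD_fun (is_deriveZ_fun _ (dPh s s0))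
      (is_deriveZ_fun _ (is_deriveM_fun (dw s) (dK s s0))))).
  have dQ0 (s : R) : 0 <= s <= t -> dQ s <= 0.
    move=> /andP[s0 _].
    have := ler_wpM2r (expR_ge0 (- (2 * s / T))) (fK K s K0 dK s0).
    have -> : T * expR (s / T) * K s * expR (- (2 * s / T)) =
      T * (expR (- (s / T)) * K s).
      have e1 : expR (s / T) * expR (- (s / T)) = 1 by exact: expRxMexpNx_1.
      by rewrite w2 -[RHS]mul1r -e1; ring.
    rewrite /dQ; have -> : T ^+ 2 * (expR (- (s / T)) * - T^-1 * K s +
      expR (- (s / T)) * (expR (- (s / T)) * h s)) =
      T ^+ 2 * (h s * expR (- (2 * s / T))) - T * (expR (- (s / T)) * K s).
      by rewrite w2; field; rewrite gt_eqF.
    by lra.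
  have := increment_le t0 dQs dQ0.
  rewrite /Q Pf0 Ph0 K0 !mulr0 mul0r !addr0.
  have : 0 <= T ^+ 2 * (expR (- (t / T)) * K t).
    by rewrite !mulr_ge0 ?expR_ge0 ?K_ge0// ltW.
  lra.
have mw (g : R -> R) : continuous g -> measurable_fun setT (fun t => g t * expR (- (2 * t / T))).
  by move=> cg; apply: continuous_measurable_fun; exact: cwt.
(* The integral over the half-line is the supremum of those over bounded intervals, where the
   primitives compute it. *)
rewrite [leLHS]ge0_integral_ereal_sup; last exact: mw; last first.
  by move=> t; rewrite mulr_ge0 ?expR_ge0.
apply: ge_ereal_sup => _ [n _ <-].
rewrite If ?ltr0n//.
apply: (@le_trans _ _ (T ^+ 2 * Ph n.+1%:R)%:E); first by rewrite lee_fin PfPh.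
rewrite EFinM lee_wpmul2l ?lee_fin ?sqr_ge0// -Ih ?ltr0n//.
apply: ge0_subset_integral => //=.
- by apply/measurable_EFinP; apply: measurable_funS (mw _ ch).
- by move=> t _; rewrite lee_fin mulr_ge0 ?expR_ge0.
- exact: subset_itvl.
Qed.

End LaplaceWeight.

(** * Exponential of an operator with exponentially decaying matrix elements *)

Section OperatorExponential.
Variables (R : realType) (I : choiceType).

Lemma esum_single (g : I -> R) (n : I) : (forall m, 0 <= g m) ->
  (forall m, m != n -> g m = 0) -> (\esum_(m in [set: I]) (g m)%:E = (g n)%:E)%E.
Proof.
move=> g0 gn.
have := @esum_mkcond R I [set n] (fun m => (g m)%:E).
rewrite esum_set1 ?lee_fin// => ->; apply: eq_esum => m _.
case: ifPn => // mn; rewrite gn//.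
by apply/eqP => mE; move: mn; rewrite mE mem_set.
Qed.

Lemma rsum_single (f : I -> R) (n : I) :
  (forall m, m != n -> f m = 0) -> rsum f = f n.
Proof.
move=> fn; rewrite /rsum !(@esum_single _ n)/=.
- have [fn0|fn0] : 0 <= f n \/ f n <= 0 by apply/orP; exact: le_total.
    by rewrite max_l// max_r ?subr0// oppr_le0.
  by rewrite max_r// max_l ?oppr_ge0// sub0r opprK.
- by move=> m; rewrite le_max lexx orbT.
- by move=> m /fn ->; rewrite oppr0 maxxx.
- by move=> m; rewrite le_max lexx orbT.
- by move=> m /fn ->; rewrite maxxx.
Qed.

Lemma inner_delta (phi : I -> R[i]) (n : I) : inner (delta R n) phi = phi n.
Proof.
have E m : m != n -> (delta R n m)^*%C * phi m = 0.
  by move=> /negPf mn; rewrite /delta mn rmorph0 mul0r.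
rewrite /inner /csum !(@rsum_single _ n) => [|m /E ->//|m /E ->//].
by rewrite /delta eqxx rmorph1 mul1r; case: (phi n).
Qed.

Lemma normc_sq (a b : R) : normc (Complex a b) ^+ 2 = a ^+ 2 + b ^+ 2.
Proof. by rewrite /normc sqr_sqrtr// addr_ge0// sqr_ge0. Qed.

Lemma le_esumZ (a : R) (g : I -> R) (S : \bar R) : 0 <= a -> (forall n, 0 <= g n) ->
  (\esum_(n in [set: I]) (g n)%:E <= S)%E ->
  (\esum_(n in [set: I]) (a * g n)%:E <= a%:E * S)%E.
Proof.
move=> a0 g0 gS; apply: (@le_trans _ _ (a%:E * \esum_(n in [set: I]) (g n)%:E)%E); last first.
  by rewrite lee_wpmul2l.
apply: ge_ereal_sup => _ [F [finF _] <-].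
under eq_fsbigr do rewrite EFinM.
rewrite -ge0_mule_fsumr; last by move=> n; rewrite lee_fin.
rewrite lee_wpmul2l//; apply: esum_ge; exists F => //.
Qed.

Lemma l2norm_sq_ge (psi : I -> R[i]) (n : I) :
  ((normc (psi n) ^+ 2)%:E <= l2norm_sq psi)%E.
Proof.
apply: esum_ge; exists [set n]; first by split.
by rewrite fsbig_set1.
Qed.

Lemma l2norm_sq_ge0 (psi : I -> R[i]) : (0 <= l2norm_sq psi)%E.
Proof. by apply: esum_ge0 => n _; rewrite lee_fin sqr_ge0. Qed.

(** * The exponential series applied to a delta vector with real moments *)

Section Evolution.
Variables (A : (I -> R[i]) -> (I -> R[i])) (i : I) (G : nat -> I -> R).
Variables (W : I -> R) (C S : R).
Hypothesis AZ : forall z psi, A (fun n => z * psi n) = (fun n => z * A psi n).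
Hypothesis AG : forall k n, iter k A (delta R i) n = (G k n)%:C%C.
Hypothesis GW : forall k n, `|G k n| <= W n * C ^+ k.
Hypothesis C_ge0 : 0 <= C.
Hypothesis W_ge0 : forall n, 0 <= W n.
Hypothesis WS : (\esum_(n in [set: I]) (W n ^+ 2)%:E <= S%:E)%E.

Let re n k := re_powNi R k * G k n.
Let im n k := im_powNi R k * G k n.

Let re_bounded n : exp_bounded (W n) C (re n).
Proof.
move=> k; rewrite normrM -[leRHS]mul1r ler_pM//.
by have [] := powNi_le1 R k.
Qed.

Let im_bounded n : exp_bounded (W n) C (im n).
Proof.
move=> k; rewrite normrM -[leRHS]mul1r ler_pM//.
by have [] := powNi_le1 R k.
Qed.

Let sol t n := Complex (egf (re n) t) (egf (im n) t).

Let gen (t : R) (chi : I -> R[i]) (n : I) : R[i] := - ('i%C * t%:C%C) * A chi n.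

Let exp_partialE t N n :
  exp_partial (gen t) (delta R i) N n =
  Complex (pseries (fun k => re n k / k`!%:R) t N)
          (pseries (fun k => im n k / k`!%:R) t N).
Proof.
rewrite /exp_partial /pseries /series/= !big_mkord.
have iterE k : iter k (gen t) (delta R i) =
    (fun n => (- ('i%C * t%:C%C)) ^+ k * iter k A (delta R i) n).
  elim: k => [|k IH]; first by apply/funext => m; rewrite expr0 mul1r.
  by rewrite iterS IH /gen AZ; apply/funext => m /=; rewrite mulrA -exprS.
elim: N => [|N IH]; first by rewrite !big_ord0.
rewrite !big_ord_recr/= IH iterE AG -mulNr exprMn powNiE -rmorphXn.
rewrite (_ : N`!%:R^-1 = (N`!%:R^-1 : R)%:C%C); last first.
  by rewrite fmorphV rmorph_nat.
apply/eqP; rewrite eq_complex /= /re /im; apply/andP; split; apply/eqP; ring.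
Qed.

Let tail (t : R) N := expR (C * `|t|) - series (exp_coeff (C * `|t|)) N.

(** The factor 2 covers the real and the imaginary part, each with tail at most [W n * tail t N] at
    site [n]. *)
Let err_le t N :
  (l2norm_sq (fun n => exp_partial (gen t) (delta R i) N n - sol t n)%R <= (2 * tail t N ^+ 2 * S)%:E)%E.
Proof.
rewrite EFinM; apply: le_trans (le_esumZ (a := 2 * tail t N ^+ 2) _ _ WS); last 2 first.
- by rewrite mulr_ge0// sqr_ge0.
- by move=> n; rewrite sqr_ge0.
apply: le_esum => n _; rewrite lee_fin exp_partialE /sol.
rewrite (_ : Complex _ _ - Complex _ _ = Complex
  (pseries (fun k => re n k / k`!%:R) t N - egf (re n) t)
  (pseries (fun k => im n k / k`!%:R) t N - egf (im n) t))//.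
rewrite normc_sq.
have sq (u : R) : `|u| <= W n * tail t N -> u ^+ 2 <= W n ^+ 2 * tail t N ^+ 2.
  by move=> h; rewrite -exprMn -[u ^+ 2]real_normK ?num_real// lerXn2r// ?nnegrE// (le_trans _ h).
have h1 := egf_tail t N C_ge0 (re_bounded n).
have h2 := egf_tail t N C_ge0 (im_bounded n).
rewrite distrC in h1; rewrite distrC in h2.
by move: (sq _ h1) (sq _ h2); lra.
Qed.

Let tail_cvg t : tail t N @[N --> \oo] --> (0 : R).
Proof.
rewrite -(subrr (expR (C * `|t|))); apply: cvgB; first exact: cvg_cst.
exact: is_cvg_series_exp_coeff.
Qed.

Let err_cvg t :
  l2norm_sq (fun n => exp_partial (gen t) (delta R i) N n - sol t n)%R @[N --> \oo] --> 0%E.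
Proof.
apply: (@squeeze_cvge _ _ _ _ (cst 0%E) _ (fun N => (2 * tail t N ^+ 2 * S)%:E)).
- by apply: nearW => N; rewrite l2norm_sq_ge0 err_le.
- exact: cvg_cst.
- apply: cvg_EFin; first by apply: nearW.
  have -> : 0 = 2 * (0 * 0) * S :> R by ring.
  apply: cvgMl; apply: cvgMr.
  by under eq_fun do rewrite expr2; apply: cvgM; exact: tail_cvg.
Qed.

Let sol_l2 t : l2 (sol t).
Proof.
(* The empty partial sum is zero, so the error bound at N = 0 already bounds the norm of [sol t]. *)
have := err_le t 0; rewrite /l2 => h; apply: (le_lt_trans _ (ltry (2 * tail t 0 ^+ 2 * S))).
apply: le_trans h; apply: le_esum => n _; rewrite exp_partialE /sol.
rewrite (_ : Complex _ _ - Complex _ _ = Complex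
  (pseries (fun k => re n k / k`!%:R) t 0 - egf (re n) t)
  (pseries (fun k => im n k / k`!%:R) t 0 - egf (im n) t))//.
by rewrite !normc_sq /pseries /series/= !big_geq// !sub0r !sqrrN.
Qed.

(** [sol t] is an l^2 limit of the partial sums because the tails have a square summable profile
    [W]. Whatever limit [op_exp] selects has the same entries, since the l^2 norm controls each
    entry. *)
Lemma evolution_delta t n : evolution A t (delta R i) n = sol t n.
Proof.
rewrite /evolution -/(gen t) /op_exp.
set P := [set phi | _].
(* [xget] falls back on the zero vector only when no limit exists, and [sol t] is one. *)
have : P (xget (fun=> 0) P).
  by apply: (xgetPex (fun=> 0)); exists (sol t); split; [exact: sol_l2|exact: err_cvg].
set chi := xget _ P => -[_ chi_cvg].
have lim (g : nat -> R) (a : R) :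
    (forall N, ((pseries (fun k => g k / k`!%:R) t N - a) ^+ 2)%:E <=
      l2norm_sq (fun n => exp_partial (gen t) (delta R i) N n - chi n)%R)%E ->
    exp_bounded (W n) C g -> egf g t = a.
  move=> le gb.
  have c1 : ((pseries (fun k => g k / k`!%:R) t N - a) ^+ 2)%:E @[N --> \oo] --> 0%E.
    apply: (@squeeze_cvge _ _ _ _ (cst 0%E) _ _ _ _ _ chi_cvg); last exact: cvg_cst.
    by apply: nearW => N; rewrite lee_fin sqr_ge0 le.
  have c2 : (pseries (fun k => g k / k`!%:R) t N - a) ^+ 2 @[N --> \oo] --> (egf g t - a) ^+ 2.
    rewrite expr2; under eq_fun do rewrite expr2.
    by apply: cvgM; apply: cvgB; (exact: cvg_egf C_ge0 gb || exact: cvg_cst).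
  have /fine_cvg/= c3 := c1.
  have /eqP : (egf g t - a) ^+ 2 = 0.
    by rewrite -(cvg_lim _ c2)//; exact: cvg_lim.
  by rewrite sqrf_eq0 subr_eq0 => /eqP.
have H N := l2norm_sq_ge (fun n => exp_partial (gen t) (delta R i) N n - chi n)%R n.
rewrite /sol; case E : (chi n) => [u v].
have {}H N : (((pseries (fun k => re n k / k`!%:R) t N - u) ^+ 2 +
   (pseries (fun k => im n k / k`!%:R) t N - v) ^+ 2)%:E <=
   l2norm_sq (fun n => exp_partial (gen t) (delta R i) N n - chi n)%R)%E.
  by apply: le_trans (H N); rewrite exp_partialE E -normc_sq.
rewrite (lim (re n) u) => [|N|]; last exact: re_bounded; last first.
  by apply: le_trans (H N); rewrite lee_fin lerDl sqr_ge0.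
rewrite (lim (im n) v) => [//|N|]; last exact: im_bounded.
by apply: le_trans (H N); rewrite lee_fin lerDr sqr_ge0.
Qed.

End Evolution.

End OperatorExponential.

(** * Comparison of the full-line and half-line dynamics *)

Section Comparison.
Variable R : realType.
Implicit Types (V : int -> R) (T : R).

(** * Splitting and bounding sums over the integers *)

Lemma esum_int (S : set int) (a : int -> \bar R) : (forall n, (0 <= a n)%E) ->
  (\esum_(n in S) a n = \esum_(k in [set k : nat | S k%:Z]) a k%:Z +
     \esum_(k in [set k : nat | S (Negz k)]) a (Negz k))%E.
Proof.
move=> a0; rewrite (esumID (range Posz))//; congr (_ + _)%E.
- have -> : S `&` range Posz = Posz @` [set k : nat | S k%:Z].
    apply/seteqP; split => [n [Sn [k _ kn]]|_ [k Sk <-]]; last by split => //; exists k.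
    by exists k; rewrite //= kn.
  by rewrite esum_image// => k l _ _ [].
- have -> : S `&` ~` range Posz = Negz @` [set k : nat | S (Negz k)].
    apply/seteqP; split => [[k|k] [Sn nP]|_ [k Sk <-]].
    + by exfalso; apply: nP; exists k.
    + by exists k.
    + by split => // -[l _].
  by rewrite esum_image// => k l _ _ [].
Qed.

Lemma esum_nat_decay : (\esum_(k in [set: nat]) (decay R k%:Z ^+ 2)%:E <= 2%:E)%E.
Proof.
rewrite -nneseries_esumT; last by move=> k; rewrite lee_fin sqr_ge0.
apply: lime_le; first by apply: is_cvg_nneseries => k _ _; rewrite lee_fin sqr_ge0.
apply: nearW => n; rewrite sumEFin lee_fin.
(* The full sum is 4/3; the cruder bound with a subtracted term is chosen because it passes through
   the induction. *)
suff : \sum_(0 <= k < n) decay R k%:Z ^+ 2 <= 2 - 2 * decay R n%:Z ^+ 2.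
  by move=> /le_trans; apply; rewrite gerBl mulr_ge0// sqr_ge0.
elim: n => [|n IH]; first by rewrite big_geq// /decay expr0; lra.
rewrite big_nat_recr//=.
have -> : decay R n.+1%:Z = 2^-1 * decay R n%:Z by rewrite /decay -exprS.
rewrite exprMn.
by have := sqr_ge0 (decay R n%:Z); lra.
Qed.

Lemma esum_int_decay : (\esum_(n in [set: int]) (decay R n ^+ 2)%:E <= 4%:E)%E.
Proof.
rewrite esum_int; last by move=> n; rewrite lee_fin sqr_ge0.
have -> : 4%:E = (2%:E + 2%:E : \bar R)%E by rewrite -EFinD; congr EFin; lra.
have T1 : [set k : nat | [set: int] k%:Z] = setT by apply/seteqP.
rewrite T1; apply: leeD; first exact: esum_nat_decay.
apply: le_trans esum_nat_decay; apply: le_esum => k _; rewrite lee_fin.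
by rewrite lerXn2r// ?nnegrE ?decay_ge0// decay_mono.
Qed.

(** * Schrödinger operators as Jacobi operators on real sequences *)

Lemma schroedinger_real V (f : int -> R) :
  schroedinger V (fun n => (f n)%:C%C) = (fun n => (jacobi (full_bond R) V f n)%:C%C).
Proof.
apply/funext => n; rewrite /schroedinger /jacobi /full_bond !mul1r.
by rewrite !rmorphD rmorphM.
Qed.

(** Index k stands for site k + 1. At k = 0 the cut bond removes the coupling to [f 0], so the
    values of [f] at sites n <= 0 are irrelevant. *)
Lemma half_schroedinger_real V (f : int -> R) :
  schroedinger_plus V (fun k => (f k.+1%:Z)%:C%C) =
  (fun k => (jacobi (cut_bond R) V f k.+1%:Z)%:C%C).
Proof.
apply/funext => -[|k]; rewrite /schroedinger_plus /= /jacobi /cut_bond.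
  by rewrite subrr eqxx mul0r addr0 mul1r rmorphD rmorphM.
have -> : k.+2%:Z - 1 = k.+1%:Z by lia.
have -> : k.+2%:Z + 1 = k.+3%:Z by lia.
by rewrite !mul1r !rmorphD rmorphM.
Qed.

(** * Site-by-site comparison for a bounded potential *)

Section Potential.
Variables (V : int -> R) (M : R).
Hypothesis VM : forall n, `|V n| <= M.

Let C := 4 + M.

Let C_ge0 : 0 <= C.
Proof. by rewrite addr_ge0// (le_trans _ (VM 0)). Qed.

Let full_le1 n : `|full_bond R n| <= 1. Proof. by rewrite normr1. Qed.

Let cut_le1 n : `|cut_bond R n| <= 1.
Proof. by rewrite /cut_bond ger0_norm// lern1 leq_b1. Qed.

Lemma evolution_full t n : evolution (schroedinger V) t (delta R 0) n =
  Complex (jacobi_re (full_bond R) V 0 n t) (jacobi_im (full_bond R) V 0 n t).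
Proof.
apply: (@evolution_delta _ _ _ _ (jacobi_moment (full_bond R) V 0) (decay R) C 4) => //.
- move=> z psi; apply/funext => m; rewrite /schroedinger; ring.
- move=> k m; suff -> : iter k (schroedinger V) (delta R 0) =
    (fun m => (jacobi_moment (full_bond R) V 0 k m)%:C%C) by [].
  elim: k => [|k IH]; last by rewrite iterS IH schroedinger_real.
  by apply/funext => l; rewrite /delta /jacobi_moment /= rmorph_nat.
- by move=> k m; have := jacobi_moment_le full_le1 VM 0 k m; rewrite subr0.
- exact: esum_int_decay.
Qed.

Lemma evolution_half t j : evolution (schroedinger_plus V) t (delta R 0%N) j =
  Complex (jacobi_re (cut_bond R) V 1 j.+1%:Z t) (jacobi_im (cut_bond R) V 1 j.+1%:Z t).
Proof.
apply: (@evolution_delta _ _ _ _ (fun k j => jacobi_moment (cut_bond R) V 1 k j.+1%:Z)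
  (fun j => decay R j%:Z) C 2) => //.
- by move=> z psi; apply/funext => -[|m]; rewrite /schroedinger_plus /=; ring.
- move=> k m; suff -> : iter k (schroedinger_plus V) (delta R 0%N) =
    (fun m => (jacobi_moment (cut_bond R) V 1 k m.+1%:Z)%:C%C) by [].
  elim: k => [|k IH]; last by rewrite iterS IH half_schroedinger_real.
  by apply/funext => l; rewrite /delta /jacobi_moment /= rmorph_nat.
- move=> k m; have := jacobi_moment_le cut_le1 VM 1 k m.+1%:Z.
  by have -> : m.+1%:Z - 1 = m%:Z by lia.
- exact: esum_nat_decay.
Qed.

(** Duhamel's bound supplies the hypothesis of the Laplace-weighted comparison, applied to the
    squared amplitudes at site j + 1 on the full and on the cut line. *)
Lemma time_averaged_prob_le T (j : nat) : 0 < T ->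
  (time_averaged_prob (schroedinger V) (delta R j.+1%:Z) (delta R 0%R) T <=
   (T ^+ 2)%:E * time_averaged_prob (schroedinger_plus V) (delta R j) (delta R 0%N) T)%E.
Proof.
move=> T0; rewrite /time_averaged_prob muleCA lee_wpmul2l//.
  by rewrite lee_fin divr_ge0// ltW.
under eq_integral do rewrite inner_delta evolution_full normc_sq.
under [X in (_ <= _ * X)%E]eq_integral do rewrite inner_delta evolution_half normc_sq.
have sq_cont (f : R -> R) : (forall t : R, derivable f t 1) -> continuous (fun t => f t ^+ 2).
  move=> df t; under eq_fun do rewrite expr2.
  have cf : {for t, continuous f}.
    by apply: differentiable_continuous; apply/derivable1_diffP; exact: df.
  exact: cvgM.
apply: (@laplace_weight_le _ T
  (fun t => jacobi_re (full_bond R) V 0 j.+1%:Z t ^+ 2 + jacobi_im (full_bond R) V 0 j.+1%:Z t ^+ 2)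
  (fun t => jacobi_re (cut_bond R) V 1 j.+1%:Z t ^+ 2 + jacobi_im (cut_bond R) V 1 j.+1%:Z t ^+ 2)) => //.
- by move=> t; apply: cvgD; apply: sq_cont => s;
    [have h := is_derive_jacobi_re full_le1 VM 0 j.+1%:Z s
    |have h := is_derive_jacobi_im full_le1 VM 0 j.+1%:Z s];
    exact: (@ex_derive _ _ _ _ _ _ _ h).
- by move=> t; apply: cvgD; apply: sq_cont => s;
    [have h := is_derive_jacobi_re cut_le1 VM 1 j.+1%:Z s
    |have h := is_derive_jacobi_im cut_le1 VM 1 j.+1%:Z s];
    exact: (@ex_derive _ _ _ _ _ _ _ h).
- by move=> t; rewrite addr_ge0// sqr_ge0.
- by move=> t; rewrite addr_ge0// sqr_ge0.
- move=> K t K0 dK t0; exact: (duhamel_bound VM T0 t0 K0 dK).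
Qed.

End Potential.

(** Reflection fixes the initial site 0 and exchanges the two neighbours of each site, both joined
    by bonds of weight 1. *)
Lemma jacobi_moment_reflect V k n :
  jacobi_moment (full_bond R) V 0 k (- n) =
  jacobi_moment (full_bond R) (fun m => V (- m)) 0 k n.
Proof.
elim: k n => [|k IH] n; first by rewrite /jacobi_moment /= oppr_eq0.
rewrite !jacobi_momentS /jacobi /full_bond -!IH opprD opprB.
by rewrite [1 - n]addrC; ring.
Qed.

Lemma time_averaged_prob_reflect V M T n : (forall n, `|V n| <= M) ->
  time_averaged_prob (schroedinger V) (delta R (- n)) (delta R 0%R) T =
  time_averaged_prob (schroedinger (fun m => V (- m))) (delta R n) (delta R 0%R) T.
Proof.
move=> VM; have VM' m : `|V (- m)| <= M by exact: VM.
have reflect (t : R) : evolution (schroedinger V) t (delta R 0) (- n) =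
    evolution (schroedinger (fun m => V (- m))) t (delta R 0) n.
  rewrite (evolution_full VM) (evolution_full VM') /jacobi_re /jacobi_im.
  by congr (Complex (egf _ t) (egf _ t)); apply/funext => k; rewrite jacobi_moment_reflect.
pose avg (g : R -> R[i]) := ((2 / T)%:E * \int[lebesgue_measure]_(t in `[0%R, +oo[)
  (normc (g t) ^+ 2 * expR (- (2 * t / T)))%:E)%E.
have /(congr1 avg) : (fun t => inner (delta R (- n)) (evolution (schroedinger V) t (delta R 0))) =
    (fun t => inner (delta R n) (evolution (schroedinger (fun m => V (- m))) t (delta R 0))).
  by apply/funext => t; rewrite !inner_delta reflect.
by [].
Qed.

Lemma time_averaged_prob_ge0 (I : choiceType) (A : (I -> R[i]) -> I -> R[i]) phi psi T :
  0 < T -> (0 <= time_averaged_prob A phi psi T)%E.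
Proof.
move=> T0; rewrite /time_averaged_prob mule_ge0//.
  by rewrite lee_fin divr_ge0// ltW.
by apply: integral_ge0 => t _; rewrite lee_fin mulr_ge0 ?expR_ge0// sqr_ge0.
Qed.

End Comparison.

Theorem proposition1p11 (R : realType) (V : int -> R)
    (hV : bounded_potential V) (q T : R) (hq : (1 < q)%R) (hT : (0 < T)%R) :
  (P_full V q T <= (T ^+ 2)%:E * (P_plus V q T + P_minus V q T))%E.
Proof.
have [M VM] := hV; have VM' m : `|V (- m)| <= M by exact: VM.
have esumZ (I : choiceType) (S : set I) (a b : I -> \bar R) :
    (forall i, (0 <= b i)%E) -> (forall i, S i -> (a i <= (T ^+ 2)%:E * b i)%E) ->
    (\esum_(i in S) a i <= (T ^+ 2)%:E * \esum_(i in S) b i)%E.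
  move=> b0 ab; apply: ge_ereal_sup => _ [F [finF FS] <-].
  apply: (@le_trans _ _ (\sum_(i \in F) (T ^+ 2)%:E * b i)%E).
    by apply: lee_fsum => // i /FS /ab.
  rewrite -ge0_mule_fsumr// lee_wpmul2l ?lee_fin ?sqr_ge0//.
  by apply: esum_ge; exists F.
rewrite /P_full esum_int; last by move=> n; exact: time_averaged_prob_ge0.
rewrite ge0_muleDr; last 2 first.
- by apply: esum_ge0 => k _; exact: time_averaged_prob_ge0.
- by apply: esum_ge0 => k _; exact: time_averaged_prob_ge0.
apply: leeD.
(* The successor maps half-line indices to sites. It misses site 0, which lies in the nonnegative
   part but is excluded by q > 1. *)
- rewrite (@reindex_esum _ _ _ [set k : nat | q < k.+1%:R] _ S).
    apply: esumZ => [k|k _]; first exact: time_averaged_prob_ge0.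
    exact: (time_averaged_prob_le VM).
  split => [k|k l _ _ [//]|[|k]] /=; first by rewrite -pmulrn.
    by rewrite normr0 mulr0z => q0; move: hq; rewrite ltNge (ltW (lt_trans q0 _)).
  by rewrite -pmulrn => qk; exists k.
- have -> : [set k : nat | [set n : int | q < `|n|%:~R] (Negz k)] =
      [set k : nat | q < k.+1%:R].
    by apply/seteqP; split => k /=; rewrite NegzE normrN -pmulrn.
  apply: esumZ => [k|k _]; first exact: time_averaged_prob_ge0.
  (* [Negz k] is the site -(k + 1), matching index k of the half-line. After reflection the bound
     for H^+ applies, because H^- is by conversion the H^+ of the reflected potential. *)
  rewrite NegzE (time_averaged_prob_reflect _ _ VM).
  exact: (time_averaged_prob_le VM').
Qed.
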